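(* Let $R$ be a Bézout ring of stable range $1$ which has the $D$-property. Then: (i) for every $A\in R^{2\times 2}$ there exist $z,\gamma,d\in R$ such that $A\sim\begin{bmatrix} z&\gamma\\ d&0\end{bmatrix}$ and $RzR=A_*$; (ii) for every $A\in R^{2\times 2}$ there exist $a,b,c\in R$ such that $A\sim\begin{bmatrix} a&0\\ b&c\end{bmatrix}$ and $RaR=A_*$.
   Context: Rings are associative (not necessarily commutative) with $1\neq 0$. $R^{n\times m}$ denotes the $n\times m$ matrices over $R$. For matrices $A,B$ of the same size over $R$, $A\sim B$ (equivalence) means $A=PBQ$ for some invertible square matrices $P,Q$ over $R$ of suitable sizes. For $x\in R$, $RxR$ is the two-sided ideal generated by $x$. For a matrix $A=(a_{ij})$ over $R$, $A_*=\sum_{i,j}Ra_{ij}R$ is the two-sided ideal generated by the entries of $A$. A Bézout ring is a ring in which every finitely generated one-sided ideal (left or right) is a principal one-sided ideal. $R$ has stable range $1$ if, whenever $aR+bR=R$ with $a,b\in R$, there is $t\in R$ with $(a+bt)R=R$. $R$ has the $D$-property if for each $a\in R$ there is $a_*\in R$ with $RaR=a_*R=Ra_*$. *)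

(* Defs.v *)
From mathcomp Require Import all_boot all_order all_algebra.
From mathcomp Require Import boolp classical_sets.

Set Implicit Arguments.
Unset Strict Implicit.
Unset Printing Implicit Defensive.

Import GRing.Theory.
Local Open Scope ring_scope.
Local Open Scope classical_set_scope.

Definition right_ideal (R : nzRingType) (I : set R) : Prop :=
  [/\ I 0, forall x y, I x -> I y -> I (x + y) & forall x r, I x -> I (x * r)].

Definition left_ideal (R : nzRingType) (I : set R) : Prop :=
  [/\ I 0, forall x y, I x -> I y -> I (x + y) & forall r x, I x -> I (r * x)].

Definition two_sided_ideal (R : nzRingType) (I : set R) : Prop :=
  left_ideal I /\ right_ideal I.

(* xR *)
Definition rprincipal (R : nzRingType) (x : R) : set R :=
  [set x * r | r in [set: R]].

(* Rx *)
Definition lprincipal (R : nzRingType) (x : R) : set R :=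
  [set r * x | r in [set: R]].

(* RxR *)
Definition principal2 (R : nzRingType) (x : R) : set R :=
  smallest (@two_sided_ideal R) [set x].

(* A_*, the sum over i, j of the ideals R a_ij R *)
Definition entry_ideal (R : nzRingType) (m n : nat) (A : 'M[R]_(m, n)) : set R :=
  [set x | exists2 f : 'I_m -> 'I_n -> R,
     forall i j, principal2 (A i j) (f i j) & x = \sum_i \sum_j f i j].

Definition bezout_ring (R : nzRingType) : Prop :=
  (forall s : seq R,
     exists d, smallest (@right_ideal R) [set` s] = rprincipal d) /\
  (forall s : seq R,
     exists d, smallest (@left_ideal R) [set` s] = lprincipal d).

Definition stable_range1 (R : nzRingType) : Prop :=
  forall a b : R,
    [set x + y | x in rprincipal a & y in rprincipal b] = [set: R] ->
    exists t, rprincipal (a + b * t) = [set: R].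

Definition D_property (R : nzRingType) : Prop :=
  forall a : R, exists a', principal2 a = rprincipal a' /\
                           principal2 a = lprincipal a'.

(* unitmx is only available over commutative rings *)
Definition invertible_mx (R : nzRingType) (n : nat) (P : 'M[R]_n) : Prop :=
  exists Q : 'M[R]_n, P *m Q = 1%:M /\ Q *m P = 1%:M.

Definition mx_equiv (R : nzRingType) (m n : nat) (A B : 'M[R]_(m, n)) : Prop :=
  exists (P : 'M[R]_m) (Q : 'M[R]_n),
    [/\ invertible_mx P, invertible_mx Q & A = P *m B *m Q].

Definition mx22 (R : nzRingType) (a b c d : R) : 'M[R]_2 :=
  \matrix_(i < 2, j < 2)
    if i == 0 then (if j == 0 then a else b) else (if j == 0 then c else d).

(* Main.v *)
Require Import Defs.
From mathcomp Require Import all_boot all_order all_algebra.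
From mathcomp Require Import boolp classical_sets.

Set Implicit Arguments.
Unset Strict Implicit.
Unset Printing Implicit Defensive.

Import GRing.Theory.
Local Open Scope ring_scope.

(** Over a Bézout ring of stable range 1, any [a] and [b] satisfy
    [aR + bR = (a + bs)R] for a suitable [s] ([add_rmul_generates]), and, since
    stable range 1 is left-right symmetric, also [Ra + Rb = R(a + tb)] for a
    suitable [t] ([add_lmul_generates]).

    Adding a right multiple of the second column to the first turns the
    lower left entry of [A] into a generator of the right ideal of the
    second row; the lower right entry can then be cleared, leaving rows [(a,
    b)] and [(c, 0)]. As the lower right corner is [0], the upper left
    corner [a] can be replaced by [a + bs + tc] without altering [b], [c] or
    the zero. Choose [s] such that [a' = a + bs] generates [aR + bR], then
    [t] such that [z = a' + tc] generates [Ra' + Rc]. Then [a'] and [c] lie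
    in [Rz], and [a] and [b] lie in [a'R], so all entries belong to [RzR];
    equivalent matrices have the same entry ideal, hence [RzR = A_*], which
    is (i). For (ii), the same device applied to the first row [(z, g)] of
    this form makes it [(z', 0)] with [z'] a generator of [zR + gR], so that
    [RzR] is contained in [Rz'R]. *)

(** * Stable range 1 on both sides *)

Lemma stable_range1_rinv (R : nzRingType) : stable_range1 R ->
  forall a b x y : R, a * x + b * y = 1 -> exists t v, (a + b * t) * v = 1.
Proof.
move=> sr a b x y e.
have [|t tP] := sr a b.
  apply/seteqP; split=> // r _.
  exists (a * (x * r)); first by exists (x * r).
  exists (b * (y * r)); first by exists (y * r).
  by rewrite !mulrA -mulrDl e mul1r.
have : [set: R]%classic 1 by [].
by rewrite -tP => -[v _ ev]; exists t, v.
Qed.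

(** Both sides expand to the same sum; this is what carries a right inverse of
    [a + (1 - a * x) * t] over to the left in proving left-right symmetry. *)
Lemma mul_swap_identity (R : nzRingType) (a x t : R) :
  (a + t * (1 - x * a)) * (1 - x * t) = (1 - t * x) * (a + (1 - a * x) * t).
Proof.
rewrite !(mulrDl, mulrDr, mulrBl, mulrBr, mul1r, mulr1, mulrA, opprB, opprD).
rewrite !(mulNr, mulrN, opprK, mulrA) -!addrA; congr (_ + _).
by rewrite addrCA; do 2!congr (_ + _); rewrite addrCA.
Qed.

(** The left-hand form of stable range 1.  If [x * a + y * b = 1] and
    [x + y * b * t] has a right inverse [v], the element
    [a + (1 - a * t) * v * y * b] has the left inverse
    [x + t * (1 - a * x)]. *)
Lemma stable_range1_linv (R : nzRingType) : stable_range1 R ->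
  forall a b x y : R, x * a + y * b = 1 -> exists t v, v * (a + t * b) = 1.
Proof.
move=> sr a b x y e.
have [|t [v uv]] := @stable_range1_rinv R sr x (y * b) a 1.
  by rewrite mulr1.
exists ((1 - a * t) * v * y), (x + t * (1 - a * x)).
have yb : y * b = 1 - x * a by rewrite -e addrC addKr.
rewrite -(mulrA _ y) mulrDr !mulrA mul_swap_identity -yb.
rewrite -(mulrA _ _ v) uv mulr1.
have tab : t * (1 - a * x) * a = t * a * (y * b).
  by rewrite yb !(mulrBl, mulrBr) !mulr1 !mulrA.
by rewrite mulrDl tab -(mulrA _ y) mulrBl mul1r addrACA e subrr addr0.
Qed.

(** * Generators of two-generated one-sided ideals *)

(** If [1 = a * u + b * v + c] and [d * c = 0], applying stable range 1 to [a]
    and [b * v + c] yields a multiple [d * (a + b * s)] that generates [dR]. *)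
Lemma rmul_generator (R : nzRingType) :
    (forall a b x y : R, a * x + b * y = 1 ->
       exists t v, (a + b * t) * v = 1) ->
  forall d a b u v : R, d = d * a * u + d * b * v ->
  exists s k, d * b = (d * a + d * b * s) * k.
Proof.
move=> sr d a b u v dE.
pose c := 1 - (a * u + b * v).
have dc : d * c = 0 by rewrite mulrBr mulrDr !mulrA -dE mulr1 subrr.
have [|t [w tw]] := sr a (b * v + c) u 1.
  by rewrite mulr1 addrA addrC subrK.
exists (v * t), (w * b); rewrite mulrA; congr (_ * b).
rewrite -[LHS]mulr1 -tw mulrA mulrDr; congr ((_ + _) * w).
by rewrite mulrA mulrDr dc addr0 !mulrA.
Qed.

Lemma add_rmul_generates (R : nzRingType) : bezout_ring R -> stable_range1 R ->
  forall a b : R, exists s k, b = (a + b * s) * k.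
Proof.
move=> [bez _] sr a b; have [d dP] := bez [:: a; b].
have mem x : x \in [:: a; b] -> exists r, d * r = x.
  move=> xab; suff: rprincipal d x by case=> r _; exists r.
  by rewrite -dP => I [_ sI]; apply: sI.
have [[a' aE] [b' bE]] : (exists r, d * r = a) /\ (exists r, d * r = b).
  by split; apply: mem; rewrite !inE eqxx ?orbT.
have : rprincipal d d by exists 1; rewrite ?mulr1.
rewrite -dP => /(_ (fun x => exists u v, x = a * u + b * v)) [].
  split.
    split; first by exists 0, 0; rewrite !mulr0 addr0.
      move=> _ _ [u [v ->]] [u' [v' ->]]; exists (u + u'), (v + v').
      by rewrite !mulrDr addrACA.
    move=> _ r [u [v ->]]; exists (u * r), (v * r).
    by rewrite mulrDl !mulrA.
  move=> x /=; rewrite !inE => /orP[] /eqP ->.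
    by exists 1, 0; rewrite mulr1 mulr0 addr0.
  by exists 0, 1; rewrite mulr1 mulr0 add0r.
move=> u [v dE].
have [|s [k sk]] := @rmul_generator R (stable_range1_rinv sr) d a' b' u v.
  by rewrite aE bE.
by exists s, k; rewrite -aE -bE.
Qed.

Lemma add_lmul_generates (R : nzRingType) : bezout_ring R -> stable_range1 R ->
  forall a b : R, exists t k, b = k * (a + t * b).
Proof.
move=> [_ bez] sr a b; have [d dP] := bez [:: a; b].
have mem x : x \in [:: a; b] -> exists r, r * d = x.
  move=> xab; suff: lprincipal d x by case=> r _; exists r.
  by rewrite -dP => I [_ sI]; apply: sI.
have [[a' aE] [b' bE]] : (exists r, r * d = a) /\ (exists r, r * d = b).
  by split; apply: mem; rewrite !inE eqxx ?orbT.
have : lprincipal d d by exists 1; rewrite ?mul1r.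
rewrite -dP => /(_ (fun x => exists u v, x = u * a + v * b)) [].
  split.
    split; first by exists 0, 0; rewrite !mul0r addr0.
      move=> _ _ [u [v ->]] [u' [v' ->]]; exists (u + u'), (v + v').
      by rewrite !mulrDl addrACA.
    move=> r _ [u [v ->]]; exists (r * u), (r * v).
    by rewrite mulrDr !mulrA.
  move=> x /=; rewrite !inE => /orP[] /eqP ->.
    by exists 1, 0; rewrite mul1r mul0r addr0.
  by exists 0, 1; rewrite mul1r mul0r add0r.
move=> u [v dE].
(* The right-hand lemma in the opposite ring, where products are reversed. *)
have [|t [k tk]] :=
    @rmul_generator R^c (stable_range1_linv sr) d a' b' u v.
  by rewrite [LHS]dE -aE -bE.
by exists t, k; rewrite -aE -bE.
Qed.

(** * Equivalence of matrices *)

Lemma invertible_mx1 (R : nzRingType) n : invertible_mx (1%:M : 'M[R]_n).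
Proof. by exists 1%:M; rewrite mulmx1. Qed.

Lemma invertible_mxM (R : nzRingType) n (P Q : 'M[R]_n) :
  invertible_mx P -> invertible_mx Q -> invertible_mx (P *m Q).
Proof.
move=> [P' [PP' P'P]] [Q' [QQ' Q'Q]]; exists (Q' *m P').
by rewrite -!mulmxA (mulmxA Q) QQ' mul1mx PP' (mulmxA P') P'P mul1mx Q'Q.
Qed.

Lemma mx_equiv_trans (R : nzRingType) m n (A B C : 'M[R]_(m, n)) :
  mx_equiv A B -> mx_equiv B C -> mx_equiv A C.
Proof.
move=> [P [Q [Pi Qi ->]]] [P' [Q' [Pi' Qi' ->]]].
exists (P *m P'), (Q' *m Q); split; try exact: invertible_mxM.
by rewrite !mulmxA.
Qed.

Lemma mx_equiv_sym (R : nzRingType) m n (A B : 'M[R]_(m, n)) :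
  mx_equiv A B -> mx_equiv B A.
Proof.
move=> [P [Q [[P' [PP' P'P]] [Q' [QQ' Q'Q]] ->]]].
exists P', Q'; split; [by exists P | by exists Q |].
by rewrite !mulmxA P'P mul1mx -mulmxA QQ' mulmx1.
Qed.

Lemma mulmx22 (R : nzRingType) (a b c d a' b' c' d' : R) :
  mx22 a b c d *m mx22 a' b' c' d' =
  mx22 (a * a' + b * c') (a * b' + b * d') (c * a' + d * c') (c * b' + d * d').
Proof.
apply/matrixP=> i j; rewrite !mxE !big_ord_recl big_ord0 !mxE addr0 /=.
by case: (i == 0); case: (j == 0).
Qed.

Lemma mx22_1 (R : nzRingType) : mx22 1 0 0 1 = 1%:M :> 'M[R]_2.
Proof.
by apply/matrixP=> i j; rewrite !mxE; case: i j => [[|[|//]] ?] [[|[|//]] ?].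
Qed.

Lemma mx22_eta (R : nzRingType) (A : 'M[R]_2) :
  A = mx22 (A 0 0) (A 0 1) (A 1 0) (A 1 1).
Proof.
apply/matrixP=> i j; rewrite !mxE.
by case: i j => [[|[|//]] ?] [[|[|//]] ?] /=; congr (A _ _); apply: val_inj.
Qed.

Lemma invertible_mx22_lower (R : nzRingType) (s : R) :
  invertible_mx (mx22 1 0 s 1).
Proof.
exists (mx22 1 0 (- s) 1); rewrite !mulmx22 -mx22_1.
by rewrite !(mulr1, mul1r, mulr0, mul0r, addr0, add0r, subrr, addNr).
Qed.

Lemma invertible_mx22_upper (R : nzRingType) (s : R) :
  invertible_mx (mx22 1 s 0 1).
Proof.
exists (mx22 1 (- s) 0 1); rewrite !mulmx22 -mx22_1.
by rewrite !(mulr1, mul1r, mulr0, mul0r, addr0, add0r, subrr, addNr).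
Qed.

Lemma mx_equiv_add_col1 (R : nzRingType) (a b c d s : R) :
  mx_equiv (mx22 a b c d) (mx22 (a + b * s) b (c + d * s) d).
Proof.
apply: mx_equiv_sym; exists 1%:M, (mx22 1 0 s 1); split.
- exact: invertible_mx1.
- exact: invertible_mx22_lower.
- by rewrite mul1mx mulmx22 !(mulr1, mulr0, add0r).
Qed.

Lemma mx_equiv_add_col2 (R : nzRingType) (a b c d s : R) :
  mx_equiv (mx22 a b c d) (mx22 a (b + a * s) c (d + c * s)).
Proof.
apply: mx_equiv_sym; exists 1%:M, (mx22 1 s 0 1); split.
- exact: invertible_mx1.
- exact: invertible_mx22_upper.
- by rewrite mul1mx mulmx22 !(mulr1, mulr0, addr0) ![_ * s + _]addrC.
Qed.

Lemma mx_equiv_add_row1 (R : nzRingType) (a b c d t : R) :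
  mx_equiv (mx22 a b c d) (mx22 (a + t * c) (b + t * d) c d).
Proof.
apply: mx_equiv_sym; exists (mx22 1 t 0 1), 1%:M; split.
- exact: invertible_mx22_upper.
- exact: invertible_mx1.
- by rewrite mulmx1 mulmx22 !(mul1r, mul0r, add0r).
Qed.

(** * Two-sided ideals *)

Lemma principal2_id (R : nzRingType) (x : R) : principal2 x x.
Proof. by move=> I [_]; apply. Qed.

Lemma principal2_min (R : nzRingType) (I : set R) (x : R) :
  two_sided_ideal I -> I x -> (principal2 x `<=` I)%classic.
Proof. by move=> II Ix y; apply; split=> // _ ->. Qed.

Lemma principal2_ideal (R : nzRingType) (x : R) :
  two_sided_ideal (principal2 x).
Proof.
split; split.
- by move=> I [[[]]].
- move=> y z Iy Iz I II; have [[[_ D _] _] _] := II.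
  by apply: D; [apply: Iy | apply: Iz].
- by move=> r y Iy I II; have [[[_ _ M] _] _] := II; apply: M; apply: Iy.
- by move=> I [[[]]].
- move=> y z Iy Iz I II; have [[[_ D _] _] _] := II.
  by apply: D; [apply: Iy | apply: Iz].
- by move=> y r Iy I II; have [[_ [_ _ M]] _] := II; apply: M; apply: Iy.
Qed.

Lemma ideal_sum (R : nzRingType) (I : set R) (J : finType) (f : J -> R) :
  two_sided_ideal I -> (forall j, I (f j)) -> I (\sum_j f j).
Proof. by move=> [[I0 ID _] _] If; apply: (big_ind I). Qed.

Lemma entry_ideal_entry (R : nzRingType) m n (A : 'M[R]_(m, n)) i j :
  entry_ideal A (A i j).
Proof.
exists (fun i' j' => if (i' == i) && (j' == j) then A i j else 0).
  move=> i' j'; case: andP => [[/eqP -> /eqP ->]|_].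
    exact: principal2_id.
  by have [[]] := @principal2_ideal R (A i' j').
rewrite (bigD1 i) //= (bigD1 j) //= !eqxx !big1 ?addr0 //.
  by move=> i' /negPf ->; rewrite big1.
by move=> j' /negPf ->.
Qed.

Lemma entry_ideal_ideal (R : nzRingType) m n (A : 'M[R]_(m, n)) :
  two_sided_ideal (entry_ideal A).
Proof.
have pI i j := @principal2_ideal R (A i j).
have I0 : entry_ideal A 0.
  exists (fun _ _ => 0); first by move=> i j; have [[]] := pI i j.
  by rewrite big1 // => i _; rewrite big1.
have ID x y : entry_ideal A x -> entry_ideal A y -> entry_ideal A (x + y).
  move=> [f fA ->] [g gA ->]; exists (fun i j => f i j + g i j).
    by move=> i j; have [[_ D _] _] := pI i j; apply: D.
  by rewrite -big_split; apply: eq_bigr => i _; rewrite -big_split.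
split; split=> //.
- move=> r _ [f fA ->]; exists (fun i j => r * f i j).
    by move=> i j; have [[_ _ M] _] := pI i j; apply: M.
  by rewrite big_distrr; apply: eq_bigr => i _; rewrite big_distrr.
- move=> _ r [f fA ->]; exists (fun i j => f i j * r).
    by move=> i j; have [_ [_ _ M]] := pI i j; apply: M.
  by rewrite big_distrl; apply: eq_bigr => i _; rewrite big_distrl.
Qed.

Lemma mx_equiv_entries (R : nzRingType) m n (A B : 'M[R]_(m, n)) (I : set R) :
  two_sided_ideal I -> mx_equiv A B -> (forall i j, I (B i j)) ->
  forall i j, I (A i j).
Proof.
move=> II [P [Q [_ _ ->]]] IB i j; have [[_ _ ML] [_ _ MR]] := II.
rewrite mxE; apply: ideal_sum => // k; apply: MR.
by rewrite mxE; apply: ideal_sum => // l; apply: ML.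
Qed.

(** A single entry of a matrix equivalent to [A] generates [A_*] as soon as it
    generates the ideal of all entries of that matrix. *)
Lemma entry_ideal_equiv (R : nzRingType) m n (A B : 'M[R]_(m, n)) i0 j0 :
  mx_equiv A B -> (forall i j, principal2 (B i0 j0) (B i j)) ->
  principal2 (B i0 j0) = entry_ideal A.
Proof.
move=> AB zB; apply/seteqP; split.
  apply: principal2_min; first exact: entry_ideal_ideal.
  apply: mx_equiv_entries (mx_equiv_sym AB) _ _ _.
    exact: entry_ideal_ideal.
  exact: entry_ideal_entry.
have zI := @principal2_ideal R (B i0 j0).
move=> _ [f fA ->]; apply: ideal_sum => // i; apply: ideal_sum => // j.
apply: principal2_min (fA i j) => //.
exact: mx_equiv_entries zI AB zB i j.
Qed.

Lemma entry_ideal_mx22 (R : nzRingType) (A : 'M[R]_2) (z b c d : R) :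
  mx_equiv A (mx22 z b c d) ->
  principal2 z b -> principal2 z c -> principal2 z d ->
  principal2 z = entry_ideal A.
Proof.
move=> AB zb zc zd.
have zE : mx22 z b c d 0 0 = z by rewrite mxE.
rewrite -zE; apply: entry_ideal_equiv => // i j; rewrite zE mxE.
by case: (i == 0); case: (j == 0) => //; apply: principal2_id.
Qed.

(** * Reduction of two by two matrices *)

Lemma mx_equiv_corner0 (R : nzRingType) :
  bezout_ring R -> stable_range1 R ->
  forall A : 'M[R]_2, exists a b c : R, mx_equiv A (mx22 a b c 0).
Proof.
move=> bez sr A; rewrite (mx22_eta A).
move: (A 0 0) (A 0 1) (A 1 0) (A 1 1) => p q r s.
have [t [k sE]] := add_rmul_generates bez sr r s.
exists (p + q * t), (q + (p + q * t) * - k), (r + s * t).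
apply: mx_equiv_trans (mx_equiv_add_col1 _ _ _ _ t) _.
have := mx_equiv_add_col2 (p + q * t) q (r + s * t) s (- k).
by rewrite [(r + _) * - k]mulrN -sE subrr.
Qed.

(** The common core of both reductions: two successive generators, of
    [aR + bR] and then of [R(a + bs) + Rc], are formed in the upper left corner,
    and the zero in the opposite corner keeps [b] and [c] unchanged. *)
Lemma mx_equiv_corner_generates (R : nzRingType) :
  bezout_ring R -> stable_range1 R ->
  forall A : 'M[R]_2, exists z g d : R,
    [/\ mx_equiv A (mx22 z g d 0), principal2 z g & principal2 z d].
Proof.
move=> bez sr A; have [a [b [c Aabc]]] := mx_equiv_corner0 bez sr A.
have [s [k bE]] := add_rmul_generates bez sr a b.
have [t [l cE]] := add_lmul_generates bez sr (a + b * s) c.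
set z := a + b * s + t * c in cE.
have [[_ zD zL] [_ _ zR]] := @principal2_ideal R z.
have zc : principal2 z c by rewrite cE; apply: zL; apply: principal2_id.
exists z, b, c; split=> //.
  apply: mx_equiv_trans Aabc _.
  apply: mx_equiv_trans (mx_equiv_add_col1 _ _ _ _ s) _.
  apply: mx_equiv_trans (mx_equiv_add_row1 _ _ _ _ t) _.
  rewrite !(mul0r, mulr0, addr0); exists 1%:M, 1%:M.
  by rewrite mul1mx mulmx1; split=> //; apply: invertible_mx1.
rewrite bE; apply: zR.
have -> : a + b * s = z + - t * c by rewrite mulNr addrK.
by apply: zD; [apply: principal2_id | apply: zL].
Qed.

Theorem theorem2p1 (R : nzRingType) :
  bezout_ring R -> stable_range1 R -> D_property R ->
  (forall A : 'M[R]_2, exists z g d : R,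
     mx_equiv A (mx22 z g d 0) /\ principal2 z = entry_ideal A) /\
  (forall A : 'M[R]_2, exists a b c : R,
     mx_equiv A (mx22 a 0 b c) /\ principal2 a = entry_ideal A).
Proof.
move=> bez sr _; split=> A;
  have [z [g [d [Azgd zg zd]]]] := mx_equiv_corner_generates bez sr A.
  exists z, g, d; split=> //; apply: entry_ideal_mx22 Azgd zg zd _.
  by have [[]] := @principal2_ideal R z.
have [s [k gE]] := add_rmul_generates bez sr z g.
set a := z + g * s in gE.
have [[a0 aD aL] [_ _ aR]] := @principal2_ideal R a.
have ag : principal2 a g by rewrite gE; apply: aR; apply: principal2_id.
have az : principal2 a z.
  have -> : z = a + g * - s by rewrite mulrN addrK.
  by apply: aD; [apply: principal2_id | apply: aR].
have ad : principal2 a d.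
  by apply: principal2_min zd => //; apply: principal2_ideal.
have Aad : mx_equiv A (mx22 a 0 d (d * - k)).
  apply: mx_equiv_trans Azgd _.
  apply: mx_equiv_trans (mx_equiv_add_col1 _ _ _ _ s) _.
  have := mx_equiv_add_col2 a g d 0 (- k).
  by rewrite mul0r addr0 add0r [a * _]mulrN -gE subrr.
exists a, d, (d * - k); split=> //.
by apply: entry_ideal_mx22 Aad a0 ad (aR _ _ ad).
Qed.
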